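(* Let $(X,\|\cdot\|)$ be a uniformly convex Banach space with strictly convex dual space $X^{*}$. Let $J\in C^{1}(X,\mathbb{R})$ be a functional with compact derivative, and let $\mu\in C^{1}(X,\mathbb{R}_{+})$ be a convex coercive functional whose derivative is an operator $\mu':X\to X^{*}$ admitting a continuous inverse. Let $\widetilde{x}\in X$ and $r>0$ be fixed. Assume that: (i) $\inf_{x\in X}J(x)<\inf_{\mu(x)\le r}J(x)$; (ii) $\mu(\widetilde{x})<r$ and $J(\widetilde{x})<\inf_{\mu(x)=r}J(x)$; (iii) $J$ is bounded from below on $X$, i.e. there exists $C\in\mathbb{R}$ such that $J(x)\ge C$ for every $x\in X$. Then there exists a nonempty open set $A\subseteq(0,+\infty)$ such that for all $\lambda\in A$ the functional $\mu+\lambda J$ has at least three critical points in $X$.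
   Context: $\mathbb{R}_{+}=[0,+\infty)$. A functional $\mu:X\to\mathbb{R}$ on a normed space is coercive if $\lim_{\|u\|\to\infty}\mu(u)=+\infty$. Banach spaces are real. A critical point of a $C^1$ functional is a point where its derivative vanishes. *)

(* Defs.v *)
From HB Require Import structures.
From mathcomp Require Import all_boot all_order all_algebra.
From mathcomp Require Import all_classical all_reals.
From mathcomp Require Import interval_inference ereal topology normedtype.
From mathcomp Require Import derive convex.

Set Implicit Arguments.
Unset Strict Implicit.
Unset Printing Implicit Defensive.

Import Order.TTheory GRing.Theory Num.Theory.
Import numFieldNormedType.Exports.

Local Open Scope classical_set_scope.
Local Open Scope ring_scope.

Definition linear_continuous_fun (R : realType) (X : normedModType R) :
    {pred (X -> R^o)} :=
  fun f => `[< linear f /\ continuous f >].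
Arguments linear_continuous_fun {R X} : simpl never.

(** The topological dual of [X], normed below by the operator norm. *)
Record dual (R : realType) (X : normedModType R) := Dual {
  dual_val :> X -> R^o ;
  _ : linear_continuous_fun dual_val }.

Section dual_lmodule.
Context (R : realType) (X : normedModType R).

HB.instance Definition _ := [isSub for @dual_val R X].
HB.instance Definition _ := [Choice of dual X by <:].

Lemma linear_continuous_fun_submod_closed :
  submod_closed (@linear_continuous_fun R X).
Proof.
split; first by apply/asboolP; split=> [a u v|x]; [rewrite scaler0 addr0|exact: cvg_cst].
move=> a f g /asboolP[lf cf] /asboolP[lg cg]; apply/asboolP; split=> [b u v|x].
  rewrite [LHS]/(a *: f (b *: u + v) + g (b *: u + v)) lf lg.
  rewrite [in RHS]/(b *: (a *: f u + g u) + (a *: f v + g v)).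
  by rewrite !scalerDr !scalerA [b * a]mulrC; exact: addrACA.
by apply: cvgD; [apply: cvgZr; exact: cf|exact: cg].
Qed.

HB.instance Definition _ := GRing.isSubmodClosed.Build R (X -> R^o)
  (@linear_continuous_fun R X) linear_continuous_fun_submod_closed.
HB.instance Definition _ := [SubChoice_isSubLmodule of dual X by <:].

Lemma dual_linear (f : dual X) : linear f.
Proof. by case: f => f /= /asboolP[]. Qed.

Lemma dual_continuous (f : dual X) : continuous f.
Proof. by case: f => f /= /asboolP[]. Qed.

HB.instance Definition _ (f : dual X) :=
  GRing.isLinear.Build R X R^o *:%R (f : X -> R^o) (dual_linear f).

Lemma dual_ext (f g : dual X) : (forall x, f x = g x) -> f = g.
Proof. by move=> fg; apply/val_inj/funext. Qed.

Lemma dualD (f g : dual X) x : (f + g) x = f x + g x. Proof. by []. Qed.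
Lemma dualZ a (f : dual X) x : (a *: f) x = a *: f x. Proof. by []. Qed.
Lemma dual0 x : (0 : dual X) x = 0. Proof. by []. Qed.

End dual_lmodule.

Section dual_norm.
Context (R : realType) (X : normedModType R).
Implicit Types f g : dual X.

Definition dual_norm f : R := sup [set `|f x| | x in [set x : X | `|x| <= 1]].

Lemma dual_norm_has_sup f :
  has_sup [set `|f x| | x in [set x : X | `|x| <= 1]].
Proof.
split; first by exists `|f 0|, 0 => //=; rewrite normr0.
have /linear_boundedP : bounded_near f (nbhs (0 : X)).
  exact/linear_bounded_continuous/dual_continuous.
case/pinfty_ex_gt0 => M M0 fM; exists M => _ [x /= x1 <-].
by rewrite (le_trans (fM x))// ler_piMr// ltW.
Qed.

Lemma dual_norm_ub f (x : X) : `|x| <= 1 -> `|f x| <= dual_norm f.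
Proof.
by move=> x1; apply: (ub_le_sup (dual_norm_has_sup f).2); exists x.
Qed.

Lemma dual_norm_le f (M : R) :
  (forall x : X, `|x| <= 1 -> `|f x| <= M) -> dual_norm f <= M.
Proof.
move=> fM; apply: ge_sup; first by case: (dual_norm_has_sup f).
by move=> _ [x /= x1 <-]; exact: fM.
Qed.

Lemma dual_norm_ge0 f : 0 <= dual_norm f.
Proof. by apply: le_trans (@dual_norm_ub f 0 _); rewrite ?normr0. Qed.

Lemma dual_normP f (x : X) : `|f x| <= dual_norm f * `|x|.
Proof.
have [->|x0] := eqVneq x 0; first by rewrite linear0 !normr0 mulr0.
have nx0 : 0 < `|x| by rewrite normr_gt0.
rewrite -ler_pdivrMr//.
have := @dual_norm_ub f (`|x|^-1 *: x).
rewrite linearZ/= !normrZ normfV normr_id mulVf ?gt_eqF// => /(_ (lexx _)).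
by rewrite mulrC.
Qed.

Lemma ler_dual_normD f g : dual_norm (f + g) <= dual_norm f + dual_norm g.
Proof.
apply: dual_norm_le => x x1; rewrite dualD.
by rewrite (le_trans (ler_normD _ _))// lerD// dual_norm_ub.
Qed.

Lemma dual_normZ (a : R) f : dual_norm (a *: f) = `|a| * dual_norm f.
Proof.
have le b g : dual_norm (b *: g) <= `|b| * dual_norm g.
  by apply: dual_norm_le => x x1; rewrite dualZ normrZ ler_wpM2l// dual_norm_ub.
apply/eqP; rewrite eq_le le /=.
have [->|a0] := eqVneq a 0; first by rewrite normr0 mul0r dual_norm_ge0.
rewrite -ler_pdivlMl ?normr_gt0// -normfV.
by rewrite -{1}(scalerK a0 f) le.
Qed.

Lemma dual_norm0_eq0 f : dual_norm f = 0 -> f = 0.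
Proof.
move=> f0; apply: dual_ext => x; apply/eqP; rewrite -normr_le0.
by rewrite (le_trans (dual_normP _ _))// f0 mul0r.
Qed.

HB.instance Definition _ := Lmodule_isNormed.Build R (dual X)
  ler_dual_normD dual_normZ dual_norm0_eq0.

Lemma dual_normE f : `|f| = dual_norm f. Proof. by []. Qed.

End dual_norm.

Section functionals.
Context (R : realType) (X : normedModType R).
Implicit Types (f : X -> R).

(** The derivative as a map into the dual space; junk value 0 where ['d f x] is
    not continuous, which cannot occur at a point of differentiability. *)
Definition differential f (x : X) : dual X := insubd 0 ('d f x : X -> R^o).

Lemma differentialE f (x : X) : differentiable f x ->
  differential f x = 'd f x :> (X -> R).
Proof.
move=> df; rewrite /differential; apply: insubdK; apply/asboolP; split.
  exact: linearP.
exact: diff_continuous.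
Qed.

Definition C1_functional f :=
  (forall x, differentiable f x) /\ continuous (differential f).

Definition critical_point f (x : X) :=
  differentiable f x /\ differential f x = 0.

Definition coercive f :=
  forall M : R, exists K : R, forall u : X, K < `|u| -> M < f u.

End functionals.

Definition compact_operator (R : realType) (X Y : normedModType R)
    (T : X -> Y) :=
  continuous T /\
  forall B : set X, bounded_set B -> compact (closure (T @` B)).

Definition has_continuous_inverse (S T : topologicalType) (f : S -> T) :=
  exists g : T -> S, [/\ cancel f g, cancel g f & continuous g].

Definition uniformly_convex (R : realType) (X : normedModType R) :=
  forall e : R, 0 < e -> exists2 d : R, 0 < d &
    forall x y : X, `|x| = 1 -> `|y| = 1 -> e <= `|x - y| ->
      `|2^-1 *: (x + y)| <= 1 - d.

Definition strictly_convex (R : realType) (X : normedModType R) :=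
  forall x y : X, `|x| = 1 -> `|y| = 1 -> x <> y -> `|2^-1 *: (x + y)| < 1.

(* Main.v *)
Require Import Defs.
From HB Require Import structures.
From mathcomp Require Import all_boot all_order all_algebra.
From mathcomp Require Import all_classical all_reals.
From mathcomp Require Import interval_inference ereal topology normedtype.
From mathcomp Require Import derive convex.
From mathcomp Require Import lra.

Set Implicit Arguments.
Unset Strict Implicit.
Unset Printing Implicit Defensive.

Import Order.TTheory GRing.Theory Num.Theory.
Import numFieldNormedType.Exports.

Local Open Scope classical_set_scope.
Local Open Scope ring_scope.

(** Put f = mu + l J and let K x be the point with mu'(K x) = - l J'(x).
    Convexity of mu makes V x = K x - x a continuous descent direction, that
    is f'(x)(V x) < 0 unless x is critical. The derivative of J being compact,
    K maps the bounded sublevel set {f <= M} into a compact convex set C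
    (Mazur), and x + s V x stays in C for s in [0, 1]. So critical points can be
    searched for in C, where compactness replaces the Palais-Smale condition.
    For l large there are a and b = r + l inf_{mu = r} J such that
    mu xt < r < mu a and f(xt), f(a) < b <= f on {mu = r}: the minimizers of f on the parts of C
    inside and outside {mu = r} are two critical points below level b. A third
    one, at a level at least b, is given by the minimax over the connected
    subsets of C joining xt to a. *)

(** * Convexity, total boundedness and compact convex enclosures *)

Section compact_convex.
Context (R : realType).

Lemma convE (X : lmodType R) (x y : convex_lmodType X) (l : {i01 R}) :
  conv l x y = y + l%:num *: (x - y) :> X.
Proof.
rewrite [LHS]/(l%:num *: (x : X) + (1 - l%:num) *: (y : X)).
by rewrite scalerBr scalerBl scale1r addrCA.
Qed.

Lemma ex_i01 (s : R) : 0 <= s <= 1 -> exists l : {i01 R}, l%:num = s.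
Proof.
move=> s01.
have s01' : Itv.spec (@Itv.num_sem R) (Itv.Real `[0, 1]%Z) s.
  by rewrite /= /Itv.num_sem num_real/= in_itv.
by exists (Itv.mk s01').
Qed.

Lemma convex_setP (X : lmodType R) (A : set X) :
  convex_set A <->
  forall (x y : X) (s : R), 0 <= s <= 1 -> A x -> A y -> A (x + s *: (y - x)).
Proof.
split=> [cA x y s /ex_i01[l <-] Ax Ay|cA x y l /set_mem Ax /set_mem Ay].
  by rewrite -convE; exact/set_mem/cA/mem_set/Ax/mem_set.
by apply/mem_set; rewrite convE; apply: cA => //; rewrite ge0 le1.
Qed.

Lemma convex_functionP (X : lmodType R) (f : X -> R) :
  convex_function (setT : set X) f ->
  forall (x y : X) (s : R), 0 <= s <= 1 ->
    f (x + s *: (y - x)) <= f x + s * (f y - f x).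
Proof.
move=> cf x y s /ex_i01[l <-].
have /= := cf l y x (in_setT _) (in_setT _).
rewrite convE => /le_trans; apply.
rewrite [leLHS]/(l%:num * f y + (1 - l%:num) * f x).
by rewrite mulrBr mulrBl mul1r addrCA.
Qed.

(** An ultrafilter containing [A] contains a ball from each finite cover, so it is Cauchy;
    completeness gives a limit, which lies in [A] by closedness. *)
Lemma complete_totally_bounded_compact (X : completeNormedModType R)
    (A : set X) :
  closed A ->
  (forall e : R, 0 < e -> exists s : seq X,
    forall x, A x -> exists2 y, y \in s & `|y - x| < e) ->
  compact A.
Proof.
move=> clA tbA; rewrite compact_ultra => F FU FA.
suff /cauchy_cvgP/cvg_ex[p Fp] : cauchy F.
  exists p; split => //.
  exact: (closed_cvg (u_ := id) _ clA FA).
apply: cauchy_exP => e /tbA[s As].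
have : F (\bigcup_(y in [set` s]) ball y e).
  apply: filterS FA => x /As[y ys yx]; exists y => //.
  by rewrite -ball_normE.
elim: s {As} => [|y s IH] Fs.
  by move: Fs; rewrite set_nil bigcup_set0 => /filter_ex[].
have [Fy|nFy] := in_ultra_setVsetC (ball y e) FU; first by exists y.
apply: IH; apply: filterS (filterI nFy Fs) => x [nyx [z /=]].
by rewrite inE => /predU1P[->//|zs zx]; exists z.
Qed.

Lemma compact_totally_bounded (X : normedModType R) (A : set X) (e : R) :
  compact A -> 0 < e ->
  exists s : seq X, forall x, A x -> exists2 y, y \in s & `|y - x| < e.
Proof.
rewrite compact_cover => cA e0.
have [||D _ AD] := cA X A (fun x => ball x e).
- by move=> x _; exact: ball_open.
- by move=> x Ax; exists x => //; exact: ballxx.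
have /finite_seqP[s Ds] := finite_fset D.
exists s => x /AD[y yD yx]; exists y; first by rewrite Ds in yD.
by move: yx; rewrite -ball_normE.
Qed.

(* A sum of segments [0, 1] a_i is compact, convex and contains the a_i, which
   avoids computing with convex combinations. *)
Lemma seq_sub_compact_convex (X : normedModType R) (s : seq X) :
  exists K : set X, [/\ compact K, convex_set K & forall x, x \in s -> K x].
Proof.
suff [K [cK vK K0 Ks]] : exists K : set X,
    [/\ compact K, convex_set K, K 0 & forall x, x \in s -> K x] by exists K.
elim: s => [|a s [K [cK /convex_setP vK K0 Ks]]].
  exists [set 0]; split=> //; first exact: compact_set1.
  apply/convex_setP => u v l _ -> ->.
  by rewrite subrr scaler0 addr0.
exists ((fun p : X * R => p.1 + p.2 *: a) @` (K `*` `[0, 1])); split.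
- apply: continuous_compact.
    apply: continuous_subspaceT => p; apply: cvgD; first exact: cvg_fst.
    by apply: cvgZl; exact: cvg_snd.
  by apply: compact_setX => //; exact: segment_compact.
- apply/convex_setP => u v l /[dup] l01 /andP[l0 l1].
  move=> [[x b] [/= Kx b01] <-] [[y c] [/= Ky c01] <-].
  move: b01 c01; rewrite !in_itv/= => /andP[b0 b1] /andP[c0 c1].
  exists (x + l *: (y - x), b + l * (c - b)); first split => //=.
  + exact: vK.
  + by rewrite in_itv/=; apply/andP; split; nra.
  + rewrite /= [(b + _) *: a]scalerDl addrACA; congr (_ + _).
    by rewrite -scalerA -scalerDr opprD addrACA -scalerBl.
- by exists (0, 0); rewrite ?scale0r ?addr0//; split => //=;
    rewrite in_itv/= lexx ler01.
- move=> x; rewrite inE => /predU1P[->|xs].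
    by exists (0, 1); rewrite ?scale1r ?add0r//; split => //=;
      rewrite in_itv/= lexx ler01.
  exists (x, 0); rewrite ?scale0r ?addr0//; split => /=; first exact: Ks.
  by rewrite in_itv/= lexx ler01.
Qed.

Lemma compact_sub_compact_convex (X : completeNormedModType R) (L : set X) :
  compact L -> exists C : set X, [/\ compact C, convex_set C & L `<=` C].
Proof.
move=> cL.
have /choice[K KP] : forall e : R, exists K : set X, 0 < e ->
    [/\ compact K, convex_set K &
      forall x, L x -> exists2 y, K y & `|y - x| < e].
  move=> e; have [e0|] := boolP (0 < e); last by exists set0.
  have [s Ls] := compact_totally_bounded cL e0.
  have [K [cK vK Ks]] := seq_sub_compact_convex s.
  by exists K; split => // x /Ls[y /Ks Ky yx]; exists y.
(* This is the intersection over [e] of the closed [e]-neighbourhoods of the [K e]; letting [d]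
   range above [e] makes it closed. *)
exists [set x | forall e d, 0 < e -> e < d -> exists2 y, K e y & `|y - x| < d].
split.
- apply: complete_totally_bounded_compact.
    move=> x clx e d e0 ed.
    have de0 : 0 < (d - e) / 2 by lra.
    have [z [/(_ e ((d + e) / 2) e0)]] := clx _ (nbhsx_ballx x _ de0).
    have /[swap]/[apply] : e < (d + e) / 2 by lra.
    move=> [y Ky yz]; rewrite -ball_normE/= => xz; exists y => //.
    have -> : y - x = (y - z) - (x - z) by rewrite opprB addrA subrK.
    by apply: le_lt_trans (ler_normB _ _) _; lra.
  (* Each point is within [e / 2] of [K (e / 4)], so an [e / 2]-net of that compact set is an
     [e]-net here. *)
  move=> e e0; have e40 : 0 < e / 4 by lra.
  have [cK _ _] := KP _ e40.
  have e20 : 0 < e / 2 by lra.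
  have [s Ks] := compact_totally_bounded cK e20.
  exists s => x /(_ _ _ e40); have /[swap]/[apply] : e / 4 < e / 2 by lra.
  move=> [y /Ks[z zs zy] yx]; exists z => //.
  have -> : z - x = (z - y) + (y - x) by rewrite addrA subrK.
  by apply: le_lt_trans (ler_normD _ _) _; lra.
- apply/convex_setP => x y l /[dup] l01 /andP[l0 l1] Cx Cy e d e0 ed.
  have [x' Kx' xx'] := Cx e d e0 ed; have [y' Ky' yy'] := Cy e d e0 ed.
  have [_ /convex_setP vK _] := KP e e0.
  exists (x' + l *: (y' - x')); first exact: vK.
  have -> : x' + l *: (y' - x') - (x + l *: (y - x)) =
      (1 - l) *: (x' - x) + l *: (y' - y).
    rewrite opprD addrACA -scalerBr scalerBl scale1r -[RHS]addrA; congr (_ + _).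
    rewrite [RHS]addrC -scalerBr !opprB addrACA; congr (_ *: _).
    by rewrite [- x' - y]addrC addrACA.
  apply: le_lt_trans (ler_normD _ _) _.
  rewrite !normrZ (ger0_norm l0) ger0_norm ?subr_ge0//.
  (* The strict inequality comes from the [x] term when [l = 0] and from the [y] term otherwise. *)
  have [->|l0'] := eqVneq l 0; first by rewrite subr0 mul1r mul0r addr0.
  have : 0 < l by rewrite lt_neqAle eq_sym l0'.
  nra.
- move=> x Lx e d e0 ed; have [_ _ /(_ _ Lx)[y Ky yx]] := KP e e0.
  by exists y => //; exact: lt_trans ed.
Qed.

End compact_convex.

(** * Differentials along lines and descent directions *)

Section descent.
Context (R : realType) (X : normedModType R).

(** In [(f t - g) (u t) + g (u t)] the first term is at most the product of the norms, which tends
    to [0], and the second converges by continuity of [g]. *)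
Lemma cvg_dual_eval (T : Type) (F : set_system T) (FF : Filter F)
    (f : T -> dual X) (u : T -> X) (g : dual X) (x : X) :
  f @ F --> g -> u @ F --> x -> (fun t => f t (u t) : R) @ F --> (g x : R).
Proof.
move=> fg ux.
have -> : (fun t => f t (u t) : R) =
    (fun t => (f t - g) (u t) + g (u t) : R).
  by apply/funext => t; rewrite -dualD subrK.
rewrite -[X in _ --> X]add0r; apply: cvgD; last first.
  by apply: (cvg_comp _ _ ux); exact: dual_continuous.
apply/norm_cvg0P.
apply: (@squeeze_cvgr _ _ _ _ (fun=> 0) (fun t => `|f t - g| * `|u t|)).
- by near=> t; apply/andP; split; [exact: normr_ge0|exact: dual_normP].
- exact: cvg_cst.
- rewrite -(mul0r `|x|); apply: cvgM; last exact: cvg_norm.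
  rewrite -(normr0 (dual X)) -(subrr g); apply: cvg_norm.
  by apply: cvgB => //; exact: cvg_cst.
Unshelve. all: by end_near. Qed.

Lemma C1_functional_continuous (f : X -> R) : C1_functional f -> continuous f.
Proof. by case=> df _ x; exact/differentiable_continuous/df. Qed.

Lemma differential_app (f : X -> R) (x v : X) :
  differentiable f x -> differential f x v = 'd f x v :> R.
Proof. by move/differentialE => /(congr1 (@^~ v)). Qed.

Lemma differentialD (f g : X -> R) (x : X) :
  differentiable f x -> differentiable g x ->
  differential (f + g) x = differential f x + differential g x.
Proof.
move=> df dg; apply/dual_ext => v.
apply: etrans (differential_app v (differentiableD df dg)) _.
apply: etrans (congr1 (@^~ v) (diffD df dg)) _.
by apply: (f_equal2 +%R); exact/esym/differential_app.
Qed.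

Lemma differentialZ (l : R) (f : X -> R) (x : X) :
  differentiable f x -> differential (l *: f) x = l *: differential f x.
Proof.
move=> df; apply/dual_ext => v.
apply: etrans (differential_app v (differentiableZ l df)) _.
apply: etrans (congr1 (@^~ v) (diffZ l df)) _.
by apply: (congr1 ( *:%R l)); exact/esym/differential_app.
Qed.

Lemma is_derive_line (f : X -> R) (x v : X) (s : R) :
  differentiable f (x + s *: v) ->
  is_derive s (1 : R) (fun t : R => f (x + t *: v))
    (differential f (x + s *: v) v).
Proof.
move=> df; have qE :
    (fun h : R => h^-1 *: (((fun t : R => f (x + t *: v)) \o shift s) (h *: 1)
       - f (x + s *: v))) =
    (fun h : R => h^-1 *: ((f \o shift (x + s *: v)) (h *: v)
       - f (x + s *: v))).
  apply/funext => h /=; congr (_ *: (f _ - _)).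
  by rewrite [h *: 1]mulr1 scalerDl addrCA.
apply: DeriveDef.
  by rewrite /derivable qE; exact: (diff_derivable df).
by rewrite /derive qE differential_app// -deriveE.
Qed.

Lemma mean_value_line (f : X -> R) (x v : X) (s : R) :
  (forall y, differentiable f y) -> 0 < s ->
  exists2 t : R, 0 < t < s &
    f (x + s *: v) - f x = s * differential f (x + t *: v) v.
Proof.
move=> df s0.
have d t : is_derive t (1 : R) (fun t : R => f (x + t *: v))
    (differential f (x + t *: v) v) by exact: is_derive_line.
have [|t] := @MVT R _ _ 0 s s0 (fun t _ => d t).
  apply: continuous_subspaceT => t.
  by apply/differentiable_continuous/derivable1_diffP; have [] := d t.
rewrite in_itv/= scale0r addr0 subr0 => t0s ->.
by exists t; rewrite // mulrC.
Qed.

Lemma line_continuous (x v : X) : continuous (fun s : R => x + s *: v).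
Proof.
by move=> s; apply: cvgD; [exact: cvg_cst|apply: cvgZ; [|exact: cvg_cst]].
Qed.

(** One-sided, because convexity and constrained minimality give inequalities only for small
    [s > 0]. *)
Lemma cvg_right_quotient (f : X -> R) (x v : X) : differentiable f x ->
  (fun s : R => s^-1 * (f (x + s *: v) - f x)) @ 0^'+ --> differential f x v.
Proof.
move=> df; rewrite differential_app// -deriveE//.
have /cvg_dnbhs_at_right : (fun s : R => s^-1 * (f (x + s *: v) - f x)) @ 0^'
    --> 'D_v f x.
  under eq_fun do rewrite [x + _]addrC.
  exact: (diff_derivable df).
exact.
Qed.

Lemma descent (f : X -> R) (x v : X) : differentiable f x ->
  differential f x v < 0 -> \forall s \near (0 : R)^'+, f (x + s *: v) < f x.
Proof.
move=> df; have /cvgr_lt/[apply] := @cvg_right_quotient f x v df.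
move=> fx; near=> s.
have s0 : 0 < s by near: s; exact: nbhs_right_gt.
have : s^-1 * (f (x + s *: v) - f x) < 0 by near: s.
by rewrite pmulr_rlt0 ?invr_gt0// subr_lt0.
Unshelve. all: by end_near. Qed.

Lemma min_differential_ge0 (f : X -> R) (x v : X) : differentiable f x ->
  (\forall s \near (0 : R)^'+, f x <= f (x + s *: v)) ->
  0 <= differential f x v.
Proof.
move=> df fx; rewrite leNgt; apply/negP => /(descent df) fv.
near (0 : R)^'+ => s.
have : f x <= f (x + s *: v) by near: s.
by rewrite leNgt => /negP; apply; near: s.
Unshelve. all: by end_near. Qed.

End descent.

(** * Deformation and minimax over connected sets *)

Section minimax.
Context (R : realType) (X : normedModType R).
Variables (f : X -> R) (V : X -> X).
Hypotheses (f1 : C1_functional f) (cV : continuous V).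

Lemma cvg_differential_line (x : X) :
  (fun p : X * R => differential f (p.1 + p.2 *: V p.1) (V p.1) : R) @ (x, 0)
    --> (differential f x (V x) : R).
Proof.
have c1 : p.1 @[p --> (x, 0 : R)] --> x by exact: cvg_fst.
have cV1 : V p.1 @[p --> (x, 0 : R)] --> V x.
  exact: (cvg_comp _ _ c1 (@cV x)).
apply: cvg_dual_eval => //.
have cx : p.1 + p.2 *: V p.1 @[p --> (x, 0 : R)] --> x.
  rewrite -[X in _ --> X]addr0 -(scale0r (V x)).
  apply: cvgD => //.
  by apply: cvgZ => //; exact: cvg_snd.
exact: (cvg_comp _ _ cx (f1.2 x)).
Qed.

(** Compactness makes pointwise descent at level [c] uniform. A single [e] serves as width of the
    level band, length of the step and slope. *)
Lemma uniform_descent (C : set X) (c : R) : compact C ->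
  (forall x, C x -> f x = c -> differential f x (V x) < 0) ->
  \forall e \near (0 : R)^'+, forall x, C x -> `|f x - c| <= e ->
    forall s, 0 <= s <= e -> differential f (x + s *: V x) (V x) <= - e.
Proof.
move=> /compact_near_coveringP cC fc; apply: cC => x Cx.
have cf := C1_functional_continuous f1.
have [fxc|fxc] := eqVneq (f x) c.
  have fx := fc x Cx fxc.
  have /cvgr_lt := @cvg_differential_line x.
  move=> /(_ (differential f x (V x) / 2)) [|]; first by lra.
  move=> [/= A B] [/= Ax [e /= e0 Be]] AB.
  near=> y d => /= _ s /andP[s0 sd].
  apply: (@le_trans _ _ (differential f x (V x) / 2)); last first.
    by rewrite lerNr; near: d; apply: nbhs_right_le; lra.
  apply/ltW/(AB (y, s)); split => /=; first by near: y.
  by apply: Be => /=; rewrite sub0r normrN ger0_norm// (le_lt_trans sd).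
(* Off the level [c], nearby points stay outside a thin enough band, so the claim is vacuous
   there. *)
have h : 0 < `|f x - c| / 2 by rewrite divr_gt0// normr_gt0 subr_eq0.
near=> y d => /= fyc; exfalso; move: fyc; apply/negP; rewrite -ltNge.
apply: (@le_lt_trans _ _ (`|f x - c| / 2)).
  by near: d; apply: nbhs_right_le.
near: y.
have : (fun y => `|f y - c|) @ x --> `|f x - c|.
  by apply: cvg_norm; apply: cvgB; [exact: cf|exact: cvg_cst].
move/cvgr_gt; apply; lra.
Unshelve. all: by end_near. Qed.

Lemma segment_image_connected (a b : X) :
  connected ((fun s : R => a + s *: (b - a)) @` `[0, 1]).
Proof.
apply: connected_continuous_connected; first exact: segment_connected.
exact/continuous_subspaceT/line_continuous.
Qed.

(** Let [c] be the infimum of the levels bounding [f] on some connected subset of [C] joining [a] to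
    [b]. If [V] strictly descended everywhere on [C] at level [c], pushing a nearly optimal set
    along [V] would bring it below [c]. Connected sets suit this since a continuous image of one is
    again connected. *)
Theorem minimax (C : set X) (a b : X) (beta M : R) :
  compact C -> convex_set C -> C a -> C b -> f a < beta -> f b < beta ->
  (forall E : set X, connected E -> E a -> E b ->
    exists2 u, E u & beta <= f u) ->
  (forall s : R, 0 <= s <= 1 -> f (a + s *: (b - a)) <= M) ->
  (forall u, C u -> f u <= M -> C (u + V u)) ->
  exists u, [/\ C u, beta <= f u, f u <= M & 0 <= differential f u (V u)].
Proof.
move=> cC /convex_setP vC Ca Cb fa fb sep segM CV.
(* The bound [t <= M] ensures that [u + V u] remains in [C] for [u] in [E]. *)
pose T := [set t : R | t <= M /\ exists E : set X,
  [/\ connected E, E `<=` C, E a, E b & forall u, E u -> f u <= t]].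
have TM : T M.
  split => //; exists ((fun s : R => a + s *: (b - a)) @` `[0, 1]); split.
  - exact: segment_image_connected.
  - by move=> _ [s /= s01 <-]; rewrite in_itv/= in s01; exact: vC.
  - by exists 0; rewrite /= ?in_itv/= ?lexx ?ler01// scale0r addr0.
  - by exists 1; rewrite /= ?in_itv/= ?lexx ?ler01// scale1r addrCA subrr addr0.
  - by move=> _ [s /= s01 <-]; rewrite in_itv/= in s01; exact: segM.
have lbT : lbound T beta.
  by move=> t [_ [E [cE _ Ea Eb Et]]]; have [u Eu /le_trans] := sep E cE Ea Eb;
    apply; exact: Et.
have iT : has_inf T by split; [exists M|exists beta].
pose c := inf T.
have betac : beta <= c by apply: lb_le_inf => //; exists M.
have cM : c <= M by apply: ge_inf => //; exists beta.
have cf := C1_functional_continuous f1.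
apply: contrapT => H.
have {H} fc x : C x -> f x = c -> differential f x (V x) < 0.
  move=> Cx fxc; rewrite ltNge; apply/negP => fx.
  by apply: H; exists x; rewrite fxc.
near ((0 : R)^'+) => e.
have e0 : 0 < e by near: e; exact: nbhs_right_gt.
have e1 : e <= 1 by near: e; exact: nbhs_right_le.
have ea : e < c - f a by near: e; apply: nbhs_right_lt; lra.
have eb : e < c - f b by near: e; apply: nbhs_right_lt; lra.
have De : forall x, C x -> `|f x - c| <= e ->
    forall s, 0 <= s <= e -> differential f (x + s *: V x) (V x) <= - e.
  by near: e; exact: uniform_descent.
have ee0 : 0 < e ^+ 2 / 4 by rewrite divr_gt0// exprn_gt0.
have [t [tM [E [cE EC Ea Eb Et]]] tc] := inf_adherent ee0 iT.
rewrite -/c in tc.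
pose g u := f u - c + e / 2.
(* the positive part of [g] *)
pose th u := (g u + `|g u|) / 2.
have th_le0 u : g u <= 0 -> th u = 0.
  by move=> gu; rewrite /th ler0_norm// subrr mul0r.
have th_ge0 u : 0 <= g u -> th u = g u.
  by move=> gu; rewrite /th ger0_norm//; lra.
(* The step vanishes below level [c - e / 2], so [a] and [b] stay fixed; on [E] it is at most [e],
   as [uniform_descent] requires. *)
pose eta u := u + th u *: V u.
have cT t' : T t' -> c <= t' by move=> Tt'; apply: ge_inf => //; exists beta.
suff : T (c - e ^+ 2 / 4) by move=> /cT; lra.
split; first lra.
have cth : continuous th.
  move=> u; have cg : g y @[y --> u] --> g u.
    by apply: cvgD; [apply: cvgB; [exact: cf|exact: cvg_cst]|exact: cvg_cst].
  by apply: cvgMl; apply: cvgD => //; exact: cvg_norm.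
have ceta : continuous eta.
  by move=> u; apply: cvgD => //; apply: cvgZ; [exact: cth|exact: cV].
have fix_eta u : f u < c - e -> eta u = u.
  by move=> fu; rewrite /eta th_le0 ?scale0r ?addr0// /g; lra.
exists (eta @` E); split.
- by apply: connected_continuous_connected => //; exact: continuous_subspaceT.
- move=> _ [u Eu <-]; have fut := Et u Eu.
  have Cu := EC u Eu; have := CV u Cu (le_trans fut tM).
  (* Then [eta u] lies on the segment from [u] to [u + V u], which is inside the convex set [C]. *)
  have thu : 0 <= th u <= 1.
    have [gu|/ltW gu] := leP (g u) 0; first by rewrite th_le0// lexx ler01.
    by rewrite th_ge0// gu/= /g; nra.
  by move=> /(vC _ _ _ thu Cu); rewrite [u + V u]addrC addrK.
- by exists a => //; rewrite fix_eta//; lra.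
- by exists b => //; rewrite fix_eta//; lra.
move=> _ [u Eu <-]; have fut := Et u Eu; have Cu := EC u Eu.
have [gu|gu] := leP (g u) 0.
  by rewrite /eta th_le0// scale0r addr0; move: gu; rewrite /g; nra.
(* With slope at most [- e], the new value is at most [c + (1 - e) * (f u - c) - e ^+ 2 / 2]. As
   [f u - c < e ^+ 2 / 4] and [e <= 1], this is at most [c - e ^+ 2 / 4]. *)
have thE : th u = f u - c + e / 2 by rewrite th_ge0// ltW.
have th0 : 0 < th u by rewrite thE.
have [s /andP[s0 sth] fE] := mean_value_line u (V u) f1.1 th0.
have fuc : `|f u - c| <= e by rewrite ler_norml; apply/andP; split; nra.
have : differential f (u + s *: V u) (V u) <= - e.
  by apply: De => //; rewrite (ltW s0)/= (le_trans (ltW sth))// thE; nra.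
rewrite -/(eta u) in fE; rewrite thE in fE th0.
move=> De'.
have : f (eta u) - f u <= (f u - c + e / 2) * - e by rewrite fE ler_pM2l.
nra.
Unshelve. all: by end_near. Qed.

End minimax.

(** * Tangents and monotonicity for convex functions *)

Section convex_differential.
Context (R : realType) (X : normedModType R).
Variable (f : X -> R).
Hypotheses (df : forall x, differentiable f x)
  (vf : convex_function (setT : set X) f).

Lemma convex_tangent_le (x y : X) :
  f x + differential f x (y - x) <= f y.
Proof.
rewrite -lerBrDl leNgt; apply/negP.
have /cvgr_gt/[apply] := @cvg_right_quotient _ _ f x (y - x) (df x).
move=> fx; near (0 : R)^'+ => s.
have s0 : 0 < s by near: s; exact: nbhs_right_gt.
have s1 : s <= 1 by near: s; exact: nbhs_right_le.
have : f y - f x < s^-1 * (f (x + s *: (y - x)) - f x) by near: s.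
rewrite ltr_pdivlMl// ltrBrDl; apply/negP; rewrite -leNgt.
by apply: convex_functionP => //; rewrite (ltW s0).
Unshelve. all: by end_near. Qed.

(** Right difference quotients dominate [p v]; using both [v] and [- v] forces equality. *)
Lemma tangent_le_differential (p : dual X) (x : X) :
  (forall y, f x + p (y - x) <= f y) -> differential f x = p.
Proof.
move=> fp; apply/dual_ext.
have ge v : p v <= differential f x v.
  rewrite leNgt; apply/negP.
  have /cvgr_lt/[apply] := @cvg_right_quotient _ _ f x v (df x).
  move=> fx; near (0 : R)^'+ => s.
  have s0 : 0 < s by near: s; exact: nbhs_right_gt.
  have : s^-1 * (f (x + s *: v) - f x) < p v by near: s.
  rewrite ltr_pdivrMl// ltrBlDl; apply/negP; rewrite -leNgt.
  by have := fp (x + s *: v); rewrite [x + _]addrC addrK linearZ.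
move=> v; apply/eqP; rewrite eq_le ge andbT.
by have := ge (- v); rewrite !linearN lerN2.
Unshelve. all: by end_near. Qed.

(** The hypothesis is the equality case of the monotonicity of the derivative. This is what turns
    failure of descent along [V] into criticality. *)
Lemma convex_differential_monotone (x y : X) :
  differential f x (x - y) <= differential f y (x - y) ->
  differential f x = differential f y.
Proof.
move=> fxy; apply: tangent_le_differential => z.
(* [x] is on the tangent of [f] at [y], which thus supports [f] at [x] too. *)
have /eqP : f y + differential f y (x - y) == f x.
  rewrite eq_le convex_tangent_le/=.
  have := convex_tangent_le x y.
  by rewrite -[y - x]opprB linearN lerBlDr => /le_trans; apply; rewrite lerD2l.
move=> <-; rewrite -addrA -linearD [x - y + _]addrC addrA subrK.
exact: convex_tangent_le.
Qed.

End convex_differential.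

(** * Level crossing and bounded sublevel sets *)

Lemma connected_crossing (R : realType) (X : topologicalType) (f : X -> R)
    (E : set X) (a b : X) (r : R) :
  continuous f -> connected E -> E a -> E b -> f a <= r -> r <= f b ->
  exists2 u, E u & f u = r.
Proof.
move=> cf cE Ea Eb ar rb.
have /connected_intervalP itv : connected (f @` E).
  by apply: connected_continuous_connected => //; exact: continuous_subspaceT.
have [|u Eu <-] := itv (f a) (f b) (imageP _ Ea) (imageP _ Eb) r.
  by rewrite ar.
by exists u.
Qed.

Lemma coercive_bounded_sublevel (R : realType) (X : normedModType R)
    (f : X -> R) (M : R) : coercive f -> bounded_set [set x | f x <= M].
Proof.
move=> /(_ M)[K fK]; rewrite /= /bounded_near; near=> N => x /= fx.
apply: (@le_trans _ _ K); last first.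
  by near: N; apply: nbhs_pinfty_ge; exact: num_real.
by rewrite leNgt; apply/negP => /fK; rewrite ltNge fx.
Unshelve. all: by end_near. Qed.

(** * Three critical points for a fixed parameter *)

Section three_critical_points.
Context (R : realType) (X : completeNormedModType R).
Variables (J mu : X -> R).
Hypotheses (J1 : C1_functional J) (J' : compact_operator (differential J)).
Hypotheses (mu1 : C1_functional mu)
  (mu_convex : convex_function (setT : set X) mu)
  (mu_coercive : coercive mu)
  (mu' : has_continuous_inverse (differential mu)).
Hypothesis J_bounded_below : exists C, forall x, C <= J x.

Theorem three_critical_points (l r beta : R) (a b : X) : 0 <= l ->
  mu a < r -> r < mu b ->
  mu a + l * J a < beta -> mu b + l * J b < beta ->
  (forall x, mu x = r -> beta <= mu x + l * J x) ->
  exists x1 x2 x3 : X,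
    [/\ x1 <> x2, x1 <> x3 & x2 <> x3] /\
    [/\ critical_point (fun x => mu x + l * J x) x1,
        critical_point (fun x => mu x + l * J x) x2 &
        critical_point (fun x => mu x + l * J x) x3].
Proof.
move=> l0 mua mub; set f := fun x : X => mu x + l * J x.
rewrite -[mu a + _]/(f a) -[mu b + _]/(f b) => fa fb fr.
have [g [gK Kg cg]] := mu'.
have dfE x : differential f x = differential mu x + l *: differential J x.
  rewrite -(differentialZ l (J1.1 x)).
  exact: (differentialD (mu1.1 x) (differentiableZ l (J1.1 x))).
have df x : differentiable f x.
  exact: (differentiableD (mu1.1 x) (differentiableZ l (J1.1 x))).
have f1 : C1_functional f.
  split => //; rewrite (funext dfE) => x.
  by apply: cvgD; [exact: mu1.2|apply: cvgZr; exact: J1.2].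
have cf := C1_functional_continuous f1.
have cmu := C1_functional_continuous mu1.
(* [h (differential J u)] is the point at which the derivative of [mu] equals
   [- (l *: differential J u)]. *)
pose h (p : dual X) := g (- (l *: p)).
have ch : continuous h.
  move=> p; have cN : (fun q : dual X => - (l *: q)) @ p --> - (l *: p).
    exact: (cvgN (cvgZ (cvg_cst l) cvg_id)).
  exact: (cvg_comp _ _ cN (cg _)).
pose V u := h (differential J u) - u.
have cV : continuous V.
  move=> u; apply: cvgB; last exact: cvg_id.
  exact: (cvg_comp _ _ (J1.2 u) (ch _)).
(* With [k = h (differential J u)], the slope is the difference of the derivatives of [mu] at [u]
   and at [k], applied to [k - u]. If it is nonnegative, these derivatives agree, which says that
   [differential f u = 0]. *)
have critical u : 0 <= differential f u (V u) -> critical_point f u.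
  move=> fu; split => //.
  have hE : differential mu (h (differential J u)) = - (l *: differential J u).
    exact: Kg.
  suff : differential mu (h (differential J u)) = differential mu u.
    by rewrite hE dfE => <-; rewrite addNr.
  apply: (convex_differential_monotone mu1.1 mu_convex).
  rewrite hE -subr_ge0; move: fu; rewrite dfE dualD.
  rewrite -/(V u); set p := l *: _.
  by have -> : (- p) (V u) = - p (V u) by []; rewrite opprK.
have [M fM] : exists M, forall s : R, 0 <= s <= 1 -> f (a + s *: (b - a)) <= M.
  have cfl : continuous (fun s : R => f (a + s *: (b - a))).
    move=> s.
    exact: (cvg_comp _ _ (@line_continuous _ _ a (b - a) s) (cf _)).
  have [s _ sM] := EVT_max ler01 (continuous_subspaceT cfl).
  by exists (f (a + s *: (b - a))) => t t01; apply: sM; rewrite in_itv.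
have fMa : f a <= M.
  by have := fM 0; rewrite scale0r addr0; apply; rewrite lexx ler01.
have fMb : f b <= M.
  have := fM 1; rewrite scale1r addrCA subrr addr0; apply.
  by rewrite lexx ler01.
have bounded_f : bounded_set [set u | f u <= M].
  have [c Jc] := J_bounded_below.
  have := coercive_bounded_sublevel (M - l * c) mu_coercive.
  rewrite /= /bounded_near; apply: filterS => N muN u /= fu; apply: muN => /=.
  by rewrite lerBrDr (le_trans _ fu)// lerD2l ler_wpM2l.
(* The points [a] and [b] are added so that the convex enclosure contains both ends of the
   minimax. *)
pose L := h @` closure (differential J @` [set u | f u <= M]) `|` [set a; b].
have cL : compact L.
  apply: compactU; last by apply: compactU; exact: compact_set1.
  apply: continuous_compact; last exact: J'.2.
  exact: continuous_subspaceT.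
have [C [cC /[dup] vC /convex_setP vC' LC]] := compact_sub_compact_convex cL.
have Ca : C a by apply: LC; right; left.
have Cb : C b by apply: LC; right; right.
have CV u : C u -> f u <= M -> C (u + V u).
  move=> _ fu; rewrite /V addrC subrK; apply: LC; left.
  exists (differential J u) => //; apply: subset_closure.
  by exists u.
(* For small [s > 0] the point [x + s *: V x] lies in both [C] and [W], so a minimizer admits no
   descent along [V]. *)
have min_critical (W : set X) x : open W -> C x -> W x -> f x <= M ->
    (forall y, C y -> W y -> f x <= f y) -> critical_point f x.
  move=> oW Cx Wx fx xmin; apply/critical/min_differential_ge0 => //.
  near=> s; apply: xmin.
    have := vC' x (x + V x) s; rewrite [x + V x - x]addrC addKr; apply => //.
      apply/andP; split; first by near: s; exact: nbhs_right_ge.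
      by near: s; exact: nbhs_right_le.
    exact: CV.
  near: s; have : (fun s : R => x + s *: V x) @ 0^'+ --> x.
    rewrite -[X in _ --> X]addr0 -(scale0r (V x)).
    exact/cvg_at_right_filter/line_continuous.
  by apply; exact: open_nbhs_nbhs.
(* Minimize over the compact part of [C] where [mu x <= r]. The minimum is below [beta], so it
   avoids [mu x = r] and lies in the open part. *)
have [x1 [x1c mux1 fx1]] : exists x,
    [/\ critical_point f x, mu x < r & f x < beta].
  have clr : closed [set x | mu x <= r].
    exact: (iffLR (continuous_closedP _) cmu _ (@closed_le _ r)).
  have [|||x] := @compact_EVT_min _ _ f (C `&` [set x | mu x <= r]).
  - by exists a; split => //; exact: ltW.
  - exact: compact_closedI.
  - exact: continuous_subspaceT.
  move=> /set_mem[Cx mux] xmin.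
  have fxa : f x <= f a by apply: xmin; rewrite inE; split => //; exact: ltW.
  have fxb := le_lt_trans fxa fa.
  have muxr : mu x < r.
    rewrite lt_neqAle mux andbT; apply/eqP => /fr.
    by rewrite leNgt fxb.
  exists x; split => //.
  apply: (min_critical [set x | mu x < r]) => //.
  - exact: (iffLR (continuousP _) cmu _ (@open_lt _ r)).
  - exact: le_trans fMa.
  - by move=> y Cy /ltW muy; apply: xmin; rewrite inE.
have [x2 [x2c mux2 fx2]] : exists x,
    [/\ critical_point f x, r < mu x & f x < beta].
  have clr : closed [set x | r <= mu x].
    exact: (iffLR (continuous_closedP _) cmu _ (@closed_ge _ r)).
  have [|||x] := @compact_EVT_min _ _ f (C `&` [set x | r <= mu x]).
  - by exists b; split => //; exact: ltW.
  - exact: compact_closedI.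
  - exact: continuous_subspaceT.
  move=> /set_mem[Cx mux] xmin.
  have fxa : f x <= f b by apply: xmin; rewrite inE; split => //; exact: ltW.
  have fxb := le_lt_trans fxa fb.
  have muxr : r < mu x.
    rewrite lt_neqAle mux andbT; apply/eqP => /esym/fr.
    by rewrite leNgt fxb.
  exists x; split => //.
  apply: (min_critical [set x | r < mu x]) => //.
  - exact: (iffLR (continuousP _) cmu _ (@open_gt _ r)).
  - exact: le_trans fMb.
  - by move=> y Cy /ltW muy; apply: xmin; rewrite inE.
(* A connected set joining [a] to [b] meets [mu u = r], where [f] is at least [beta]. *)
have [|x3 [_ fx3 _ /critical x3c]] :=
    minimax f1 cV cC vC Ca Cb fa fb _ fM CV.
  move=> E cE Ea Eb.
  have [u Eu mur] := connected_crossing cmu cE Ea Eb (ltW mua) (ltW mub).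
  by exists u => //; exact: fr.
exists x1, x2, x3; split; split => //.
- by move=> x12; move: mux1; rewrite x12 ltNge (ltW mux2).
- by move=> x13; move: fx1; rewrite x13 ltNge fx3.
- by move=> x23; move: fx2; rewrite x23 ltNge fx3.
Unshelve. all: by end_near. Qed.

End three_critical_points.

(** * Choice of the open set of parameters *)

Theorem theorem5 (R : realType) (X : completeNormedModType R)
    (hX : uniformly_convex X) (hX' : strictly_convex (dual X))
    (J : X -> R) (hJ : C1_functional J)
    (hJ' : compact_operator (differential J))
    (mu : X -> R) (hmu : C1_functional mu) (hmu_ge0 : forall x, 0 <= mu x)
    (hmu_convex : convex_function (setT : set X) mu)
    (hmu_coercive : coercive mu)
    (hmu' : has_continuous_inverse (differential mu))
    (xt : X) (r : R) (hr : 0 < r)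
    (hi : (ereal_inf [set (J x)%:E | x in [set: X]] <
           ereal_inf [set (J x)%:E | x in [set x : X | (mu x <= r)%R]])%E)
    (hii_mu : mu xt < r)
    (hii_J : ((J xt)%:E <
              ereal_inf [set (J x)%:E | x in [set x : X | (mu x = r)%R]])%E)
    (hiii : exists C : R, forall x : X, C <= J x) :
  exists A : set R,
    [/\ A !=set0, open A, A `<=` [set l : R | 0 < l] &
      forall l : R, A l -> exists x1 x2 x3 : X,
        [/\ x1 <> x2, x1 <> x3 & x2 <> x3] /\
        [/\ critical_point (fun x => mu x + l * J x) x1,
            critical_point (fun x => mu x + l * J x) x2 &
            critical_point (fun x => mu x + l * J x) x3]].
Proof.
have [_ [y _ <-] Jy] := ereal_inf_lt hi.
have {}Jy x : mu x <= r -> J y < J x.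
  move=> mux; rewrite -lte_fin; apply: (lt_le_trans Jy).
  by apply: ereal_inf_lbound; exists x.
have muy : r < mu y by rewrite ltNge; apply/negP => /Jy; rewrite ltxx.
(* The infimum is [+oo] when the level set is empty; any [b] above [J xt] then works. *)
have [b Jb bJ] : exists2 b, J xt < b & forall x, mu x = r -> b <= J x.
  have infJ x : mu x = r ->
      (ereal_inf [set (J x)%:E | x in [set x : X | mu x = r]] <= (J x)%:E)%E.
    by move=> mux; apply: ereal_inf_lbound; exists x.
  move: hii_J infJ; case: (ereal_inf _) => [b| |]//.
    by rewrite lte_fin => Jb bJ; exists b => // x /bJ; rewrite lee_fin.
  by move=> _ J_oo; exists (J xt + 1) => [|x /J_oo//]; rewrite ltrDl.
have Jyb : J y < b by apply: lt_trans Jb; exact/Jy/ltW.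
have bJ0 : 0 < b - J y by rewrite subr_gt0.
(* [l0 < l] is exactly [mu y + l * J y < r + l * b]; the same inequality at [xt] holds for every
   [l > 0]. *)
pose l0 := (mu y - r) / (b - J y).
have l0_gt0 : 0 < l0 by rewrite divr_gt0// subr_gt0.
exists [set l | l0 < l]; split.
- by exists (l0 + 1); rewrite /= ltrDl.
- exact: open_gt.
- by move=> l; apply: lt_trans.
move=> l /= l0l; have l_gt0 := lt_trans l0_gt0 l0l.
apply: (@three_critical_points _ _ J mu _ _ _ _ _ _ _ l r (r + l * b) xt y)
  => //.
- exact: ltW.
- by rewrite ltrD// ltr_pM2l.
- by move: l0l; rewrite ltr_pdivrMr// mulrBr; lra.
- by move=> x mux; rewrite mux lerD2l ler_pM2l// bJ.
Qed.
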